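(* Let $N$ be a free $\mathbb{Z}$-module of rank $d$, let $(\Delta,\{m_i\}_{i=1}^n)$ be a labelled polytope in $(N\otimes\mathbb{R})^\star$, with associated homomorphism $\beta:\mathbb{Z}^n\to N$, $\beta(e_i)=m_i\nu_i$, and associated group $K_D=\ker\bar\beta\subset(S^1)^n$ with identity component $(K_D)_0$. Define $\varphi:N\to K_D/(K_D)_0$ as follows: for $x\in N$ choose $y\in\mathbb{Z}^n\otimes\mathbb{R}$ with $\beta_{\mathbb{R}}(y)=x\otimes1$, and set $\varphi(x)=\exp(y)(K_D)_0$. Then $\varphi$ descends to an isomorphism $\bar\varphi:\mathrm{coker}\,\beta\xrightarrow{\ \cong\ }K_D/(K_D)_0$.
   Context: $(-)^\star$ denotes $\mathrm{Hom}_{\mathbb{R}}(-,\mathbb{R})$; $S^1\cong\mathbb{R}/\mathbb{Z}$; $e_1,\dots,e_n$ is the standard basis of $\mathbb{Z}^n$. A labelled polytope $(\Delta,\{m_i\}_{i=1}^n)$ in $(N\otimes\mathbb{R})^\star$ is a convex simple polytope $\Delta$ (of full dimension $d$), rational with respect to the lattice $N$, with $n$ facets $F_1,\dots,F_n$ labelled by positive integers $m_1,\dots,m_n$; $\nu_i\in N$ is the primitive element such that $\nu_i\otimes1$ is an inward pointing normal to $F_i$. Choosing an identification $N\cong\mathbb{Z}^d$, $\beta_{\mathbb{R}}=\beta\otimes\mathbb{R}$ induces $\bar\beta:(S^1)^n=\mathbb{R}^n/\mathbb{Z}^n\to(S^1)^d=\mathbb{R}^d/\mathbb{Z}^d$.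 The map $\exp:\mathbb{Z}^n\otimes\mathbb{R}\to(S^1)^n$ is the exponential (quotient) map. For $\beta_{\mathbb{R}}(y)=x\otimes1$ with $x\in N$ one has $\exp(y)\in K_D$, and the coset $\exp(y)(K_D)_0$ does not depend on the choice of $y$. *)

(* Defs.v *)
From HB Require Import structures.
From mathcomp Require Import all_boot all_order all_algebra.
From mathcomp Require Import all_classical all_reals.
From mathcomp Require Import topology normedtype.

Set Implicit Arguments.
Unset Strict Implicit.
Unset Printing Implicit Defensive.

Import Order.TTheory GRing.Theory Num.Theory.
Import numFieldNormedType.Exports.

Local Open Scope classical_set_scope.
Local Open Scope ring_scope.
Local Open Scope quotient_scope.

Section AffineGeometry.
Variables (R : realType) (W : vectType R).
Implicit Type A : set W.

Definition conv_hull (s : seq W) : set W :=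
  [set x | exists a : 'I_(size s) -> R,
    [/\ forall i, 0 <= a i, \sum_i a i = 1 & x = \sum_i a i *: s`_i]].

Definition is_polytope A : Prop := exists s : seq W, A = conv_hull s.

Definition contains_differences (U : {vspace W}) A : Prop :=
  forall x y, A x -> A y -> x - y \in U.

(* The affine hull of A has dimension k: its direction, the least subspace
   containing all differences of points of A, has dimension k. *)
Definition has_dim A (k : nat) : Prop :=
  A !=set0 /\ exists U : {vspace W},
    [/\ contains_differences U A,
        forall U', contains_differences U' A -> (U <= U')%VS
      & \dim U = k].

End AffineGeometry.

Section Faces.
Variables (R : realType) (V : vectType R).
Local Notation "V ^*" := 'Hom(V, R^o).
Implicit Types D F : set (V^*).

(* v = 0 is allowed, so D itself is a face of D; the empty set is not. *)
Definition is_face D F : Prop :=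
  F !=set0 /\ exists (v : V) (r : R),
    (forall eta, D eta -> r <= eta v) /\ F = D `&` [set eta | eta v = r].

Definition is_facet D F : Prop :=
  is_face D F /\ exists2 k, has_dim D k.+1 & has_dim F k.

Definition is_vertex D (eta : V^*) : Prop := is_face D [set eta].

Definition is_normal F (v : V) : Prop :=
  v != 0 /\ forall eta eta', F eta -> F eta' -> eta v = eta' v.

Definition inward_normal D F (v : V) : Prop :=
  is_normal F v /\ forall eta0 eta, F eta0 -> D eta -> eta0 v <= eta v.

End Faces.

(* nu = 0 is excluded by k = 2, w = 0. *)
Definition primitive (N : zmodType) (nu : N) : Prop :=
  forall (k : nat) (w : N), nu = w *+ k -> k = 1%N.

(* A free Z-module N of rank d is given with an isomorphism c : N -> Z^d, and
   N (x) R is R^d, with x (x) 1 the real vector with the coordinates of x. *)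
Definition tens1 (R : realType) (d : nat) (N : zmodType)
    (c : {additive N -> 'rV[int]_d}) (x : N) : 'rV[R]_d :=
  map_mx intr (c x).
Arguments tens1 R {d N} c x.

Section LabelledPolytope.
Variables (R : realType) (d n : nat) (N : zmodType).
Variable c : {additive N -> 'rV[int]_d}.

Local Notation dualN := 'Hom('rV[R]_d, R^o).

Record labelled_polytope := LabelledPolytope {
  carrier : set dualN;
  facet : 'I_n -> set dualN;
  label : 'I_n -> nat;
  carrier_polytope : is_polytope carrier;
  carrier_full_dim : has_dim carrier d;
  facet_inj : injective facet;
  facetP : forall F, is_facet carrier F <-> exists i, F = facet i;
  carrier_simple :
    forall eta, is_vertex carrier eta -> #|[pred i | `[< facet i eta >]]| = d;
  carrier_rational :
    forall i, exists x : N, is_normal (facet i) (tens1 R c x);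
  label_gt0 : forall i, (0 < label i)%N
}.

Definition primitive_inward_normal (P : labelled_polytope) (i : 'I_n) (nu : N) :
    Prop :=
  primitive nu /\ inward_normal (carrier P) (facet P i) (tens1 R c nu).

End LabelledPolytope.

Section Torus.
Variables (R : realType) (n : nat).

Definition int_rV : {pred 'rV[R]_n} := [pred y | y \is a mxOver Num.int].

Let int_rV_zmod : zmod_closed int_rV.
Proof.
split=> [|x y]; rewrite !inE; first exact/mxOver0/rpred0.
move=> /mxOverP xi /mxOverP yi; apply/mxOverP => i j.
by rewrite !mxE rpredB.
Qed.
HB.instance Definition _ := GRing.isZmodClosed.Build _ int_rV int_rV_zmod.

(* (S^1)^n as R^n / Z^n *)
Definition torus := Quotient.quot int_rV.
HB.instance Definition _ := GRing.Zmodule.on torus.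
HB.instance Definition _ := EqQuotient.on torus.

Definition torus_open (U : set torus) := open (\pi_torus @^-1` U).

Let torus_openT : torus_open setT.
Proof. by rewrite /torus_open preimage_setT; exact: openT. Qed.

Let torus_openI (A B : set torus) :
  torus_open A -> torus_open B -> torus_open (A `&` B).
Proof. exact: openI. Qed.

Let torus_open_bigU (I : Type) (f : I -> set torus) :
  (forall i, torus_open (f i)) -> torus_open (\bigcup_i f i).
Proof. by move=> fo; apply: bigcup_open => i _; exact: fo. Qed.

HB.instance Definition _ :=
  isOpenTopological.Build torus torus_openT torus_openI torus_open_bigU.

Definition exp (y : 'rV[R]_n) : torus := \pi_torus y.

Lemma expB : {morph exp : x y / x - y}.
Proof. by move=> x y; rewrite /exp !piE. Qed.

HB.instance Definition _ := GRing.isZmodMorphism.Build _ _ exp expB.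

Lemma exp_eq0 y : (exp y == 0) = (y \in int_rV).
Proof. by rewrite -(raddf0 exp) /exp -Quotient.idealrBE subr0. Qed.

Lemma exp_continuous : continuous exp.
Proof. by apply/continuousP. Qed.

Lemma torus_continuous (Z : topologicalType) (f : torus -> Z) :
  continuous (f \o exp) -> continuous f.
Proof. by move=> /continuousP cf; apply/continuousP => A oA; exact: cf. Qed.

Lemma torus_subl_continuous (a : torus) : continuous (fun b => a - b).
Proof.
apply: torus_continuous.
have -> : (fun b => a - b) \o exp = exp \o (fun y => repr a - y).
  by apply: funext => y /=; rewrite raddfB /= [exp (repr a)]reprK.
move=> y; apply: continuous_comp; last exact: exp_continuous.
by apply: continuousB; [exact: cst_continuous|].
Qed.

End Torus.

Arguments torus_subl_continuous {R n}.

Section Groups.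
Variables (R : realType) (d n : nat) (N : zmodType).
Variables (c : {additive N -> 'rV[int]_d}) (beta : {additive 'rV[int]_n -> N}).

Definition im_beta : {pred N} := [pred x | `[< exists z, x = beta z >]].

Let im_beta_zmod : zmod_closed im_beta.
Proof.
split=> [|_ _ /asboolP[z ->] /asboolP[t ->]]; apply/asboolP.
  by exists 0; rewrite raddf0.
by exists (z - t); rewrite raddfB.
Qed.
HB.instance Definition _ := GRing.isZmodClosed.Build N im_beta im_beta_zmod.

Definition coker := Quotient.quot im_beta.
HB.instance Definition _ := GRing.Zmodule.on coker.
HB.instance Definition _ := EqQuotient.on coker.

Definition betaR (y : 'rV[R]_n) : 'rV[R]_d :=
  \sum_i y 0 i *: tens1 R c (beta (delta_mx 0 i)).

Lemma betaRB : {morph betaR : x y / x - y}.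
Proof.
by move=> x y; rewrite /betaR -sumrB; apply: eq_bigr => i _; rewrite !mxE scalerBl.
Qed.
HB.instance Definition _ := GRing.isZmodMorphism.Build _ _ betaR betaRB.

Lemma tens1B : {morph tens1 R c : x y / x - y}.
Proof. by move=> x y; rewrite /tens1 raddfB map_mxB. Qed.
HB.instance Definition _ := GRing.isZmodMorphism.Build _ _ (tens1 R c) tens1B.

Lemma betaR_tens1 (z : 'rV[int]_n) : betaR (map_mx intr z) = tens1 R c (beta z).
Proof.
rewrite [in RHS](row_sum_delta z) !raddf_sum; apply: eq_bigr => i _ /=.
by rewrite mxE scaler_int -[in RHS](intz (z 0 i)) scaler_int !raddfMz.
Qed.

Lemma tens1_int x : tens1 R c x \in @int_rV R d.
Proof. by apply/mxOverP => i j; rewrite mxE intr_int. Qed.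

Lemma betaR_int y : y \in @int_rV R n -> betaR y \in @int_rV R d.
Proof.
move=> /mxOverP yi; rewrite (_ : y = map_mx intr (map_mx Num.floor y)).
  by rewrite betaR_tens1 tens1_int.
by apply/matrixP => i j; rewrite !mxE; have /floorK := yi i j.
Qed.

Definition betabar (t : torus R n) : torus R d := exp (betaR (repr t)).

Lemma betabar_exp y : betabar (exp y) = exp (betaR y).
Proof.
apply/eqP; rewrite -subr_eq0 -raddfB exp_eq0 -raddfB betaR_int //.
by rewrite -exp_eq0 raddfB /= [exp (repr _)]reprK subrr.
Qed.

Lemma betabarB : {morph betabar : x y / x - y}.
Proof.
move=> x y; rewrite -[x]reprK -[y]reprK -![\pi_(_) _]/(exp _) -raddfB.
by rewrite !betabar_exp !raddfB.
Qed.
HB.instance Definition _ := GRing.isZmodMorphism.Build _ _ betabar betabarB.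

Definition KD_pred : {pred torus R n} := [pred t | betabar t == 0].

Let KD_zmod : zmod_closed KD_pred.
Proof.
split=> [|x y]; rewrite !inE ?raddf0 // => /eqP x0 /eqP y0.
by rewrite betabarB x0 y0 subrr.
Qed.
HB.instance Definition _ := GRing.isZmodClosed.Build _ KD_pred KD_zmod.

Record KD := MkKD { KD_val : torus R n; _ : KD_val \in KD_pred }.
HB.instance Definition _ := [isSub for KD_val].
HB.instance Definition _ := [Choice of KD by <:].
HB.instance Definition _ := [SubChoice_isSubZmodule of KD by <:].

Definition KD0_pred : {pred KD} :=
  [pred k : KD | `[< connected_component [set` KD_pred] 0 (val k) >]].

Let KD0_zmod : zmod_closed KD0_pred.
Proof.
split=> [|a b /asboolP KDa /asboolP KDb]; apply/asboolP.
  by apply: connected_component_refl; exact: (rpred0 KD_pred).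
apply: (connected_component_trans KDa).
exists ((fun t => val a - t) @` connected_component [set` KD_pred] 0).
  split.
  - exists 0; last by rewrite subr0.
    by apply: connected_component_refl; exact: (rpred0 KD_pred).
  - move=> _ [t /connected_component_sub /= tKD <-]; apply: rpredB => //.
    exact: valP.
  - apply: connected_continuous_connected; first exact: component_connected.
    exact/continuous_subspaceT/torus_subl_continuous.
by exists (val b) => //; rewrite raddfB.
Qed.
HB.instance Definition _ := GRing.isZmodClosed.Build KD KD0_pred KD0_zmod.

Definition pi0_KD := Quotient.quot KD0_pred.
HB.instance Definition _ := GRing.Zmodule.on pi0_KD.
HB.instance Definition _ := EqQuotient.on pi0_KD.

Lemma exp_in_KD x y : betaR y = tens1 R c x -> exp y \in KD_pred.
Proof. by move=> yx; rewrite inE betabar_exp yx exp_eq0 tens1_int. Qed.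

Definition exp_KD x y (yx : betaR y = tens1 R c x) : KD := MkKD (exp_in_KD yx).

(* The junk value 0 is used only where x (x) 1 has no preimage. *)
Definition phi (x : N) : pi0_KD :=
  match pselect (exists y, betaR y = tens1 R c x) with
  | left ex => \pi_pi0_KD (exp_KD (projT2 (cid ex)))
  | right _ => 0
  end.

End Groups.

Arguments im_beta {n N} beta.
Arguments coker {n N} beta.
Arguments betaR {R d n N} c beta y.
Arguments betabar {R d n N} c beta t.
Arguments KD R {d n N} c beta.
Arguments pi0_KD R {d n N} c beta.
Arguments exp_KD {R d n N c beta x y} yx.
Arguments phi R {d n N} c beta x.

(* Main.v *)
Require Import Defs.
From HB Require Import structures.
From mathcomp Require Import all_boot all_order all_algebra.
From mathcomp Require Import all_classical all_reals.
From mathcomp Require Import topology normedtype.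

Set Implicit Arguments.
Unset Strict Implicit.
Unset Printing Implicit Defensive.

Import Order.TTheory GRing.Theory Num.Theory.
Import numFieldNormedType.Exports.

Local Open Scope classical_set_scope.
Local Open Scope ring_scope.
Local Open Scope quotient_scope.

(** Convexity enters the proof through one fact only: the normals of the facets
of a full-dimensional polytope D span, so that betaR is onto
([facet_normals_span], [betaR_surj]).  If they did not, some functional u <> 0
would vanish on all of them; but every u <> 0 is nonzero on the normals of some
facet ([facet_transverse]).  To find this facet, write D as the convex hull of
finitely many points, and choose v with u v <> 0 whose minimum on these points
is attained as often as possible.  If the minimizing points do not span a
hyperplane, there is a vector w <> 0 with u w = 0 that is constant on them, and
adding to v a suitable multiple of w keeps all minimizers and creates a new one,
without changing the value of u: a contradiction.

The other half is the topology of K = KD.  If betaR y = x (x) 1 then exp y lies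
in K, every point of K arises in this way, and the class of x in coker beta
depends only on exp y, since changing y by an integer vector z changes x by
beta z.  This class is locally constant on K, because distinct points of the
lattice are at distance at least 1; hence it is 0 on the identity component
([component_coker0]).  Conversely, if betaR y = 0 then the arc t |-> exp (t y)
joins 0 to exp y in K ([ker_component]).  Therefore exp y is in the identity
component exactly when x is in the image of beta, which gives both that phi is
well defined and that its kernel is the image of beta ([phi_eq0]); it is onto
since every point of K is some exp y. *)

(** * Vectors and functionals *)

Section Annihilators.
Variables (R : fieldType) (V : vectType R).
Implicit Types (W : {vspace 'Hom(V, R^o)}) (S : {vspace V}).

(** Evaluation on a basis of W is a linear map to a space of dimension \dim W,
so it has a nonzero kernel. *)
Lemma annihilated_vector W : (\dim W < \dim {:V})%N ->
  exists2 w : V, w != 0 & forall f, f \in W -> f w = 0.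
Proof.
move=> Wlt; pose b := vbasis W.
pose g (x : V) : 'rV[R]_(\dim W) := \row_i (b`_i x).
have glin : linear g.
  by move=> a x y; apply/rowP => i; rewrite !mxE linearP.
pose gM := GRing.isLinear.Build R V _ _ g glin.
pose gL : {linear V -> 'rV[R]_(\dim W)} := HB.pack g gM.
have gE x : linfun gL x = g x by rewrite lfunE.
have ker0 : (lker (linfun gL) != 0)%VS.
  apply: contraTneq Wlt => ker0; rewrite -leqNgt.
  have := limg_ker_dim (linfun gL) fullv.
  rewrite ker0 capv0 dimv0 add0n => <-.
  by apply: leq_trans (dimvS (subvf _)) _; rewrite dimvf /dim /= mul1n.
exists (vpick (lker (linfun gL))); first by rewrite vpick0.
move=> f /coord_vbasis ->; rewrite sum_lfunE big1 // => i _.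
rewrite scale_lfunE; have := memv_pick (lker (linfun gL)).
by rewrite memv_ker gE => /eqP/rowP/(_ i); rewrite !mxE => ->; rewrite scaler0.
Qed.

Lemma separating_functional (w : V) :
  w != 0 -> exists f : 'Hom(V, R^o), f w != 0.
Proof.
move=> w0; pose b := vbasis {:V}.
have [i bi] : exists i, coord b i w != 0.
  apply/existsP; apply: contraNT w0 => /existsPn b0.
  rewrite (coord_vbasis (memvf w)) big1 // => i _.
  by have /negPn/eqP -> := b0 i; rewrite scale0r.
have blin : linear (coord b i : V -> R^o) by move=> a x y; rewrite linearP.
pose g : {linear V -> R^o} :=
  HB.pack (coord b i : V -> R^o) (GRing.isLinear.Build R V R^o _ _ blin).
by exists (linfun g); rewrite lfunE.
Qed.

(** Take x outside S; projecting along S sends x to a nonzero vector, on which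
some functional is nonzero. *)
Lemma annihilating_functional S : S != fullv ->
  exists2 u : 'Hom(V, R^o), u != 0 & forall w, w \in S -> u w = 0.
Proof.
rewrite eqEsubv subvf => /subvPn[x _ xS].
pose q : 'End(V) := (\1 - projv S)%VF.
have qE w : q w = w - projv S w by rewrite add_lfunE opp_lfunE id_lfunE.
have qx : q x != 0.
  rewrite qE; apply: contraNneq xS => /eqP.
  by rewrite subr_eq0 => /eqP ->; exact: memv_proj.
have [f fqx] := separating_functional qx.
exists (f \o q)%VF.
  apply: contraNneq fqx => /lfunP/(_ x).
  by rewrite comp_lfunE zero_lfunE => ->.
by move=> w wS; rewrite comp_lfunE qE projv_id // subrr linear0.
Qed.

Lemma dim_dual : \dim {: 'Hom(V, R^o)} = \dim {:V}.
Proof. by rewrite !dimvf [LHS]muln1. Qed.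

End Annihilators.

(** * Facet normals of a full-dimensional polytope *)

Section FacetNormals.
Variables (R : realType) (V : vectType R).
Local Notation "V ^*" := 'Hom(V, R^o).

Lemma span_annihilates (X : seq V^*) (w : V) :
  {in X, forall f : V^*, f w = 0} -> {in <<X>>%VS, forall f : V^*, f w = 0}.
Proof.
move=> Xw f; rewrite -[X]in_tupleE => /coord_span ->.
rewrite sum_lfunE big1 // => i _; rewrite scale_lfunE Xw ?scaler0 //.
by rewrite in_tupleE mem_nth.
Qed.

Lemma lfunBE (f g : V^*) (w : V) : (f - g) w = f w - g w.
Proof. by rewrite add_lfunE opp_lfunE. Qed.

Lemma contains_differences_pivot (z : V^*) (U : {vspace V^*}) (A : set V^*) :
  (forall x, A x -> x - z \in U) -> contains_differences U A.
Proof.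
move=> Uz x y /Uz xz /Uz yz.
by have := memvB xz yz; rewrite opprB addrA subrK.
Qed.

Section Minimizers.
Variables (I : finType) (p : I -> V^*).

Definition minimizers (v : V) : {set I} :=
  [set i | [forall j, p i v <= p j v]].

Lemma minimizersP v i :
  reflect (forall j, p i v <= p j v) (i \in minimizers v).
Proof. by rewrite inE; exact: forallP. Qed.

(** The rotation of a supporting hyperplane about the points that it contains:
the minimizers of v stay minimal for v + t *: w as long as
t * (p i0 w - p j w) <= p j v - p i0 v for all j, and the largest such t turns
the inequality into an equality for some j that is not a minimizer of v. *)
Lemma minimizers_tilt v w i0 k :
    i0 \in minimizers v -> {in minimizers v, forall i, p i w = p i0 w} ->
    p k w < p i0 w ->
  exists t, minimizers v \proper minimizers (v + t *: w).
Proof.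
move=> /minimizersP i0min cst_w kw.
pose q j := (p j v - p i0 v) / (p i0 w - p j w).
case: (@arg_minP _ R I k (fun j => p j w < p i0 w) q kw).
move=> l lw lmin; have valE j : p j (v + q l *: w) = p j v + q l * p j w.
  by rewrite linearD linearZ.
have q_ge0 : 0 <= q l by rewrite divr_ge0 ?subr_ge0 ?i0min // ltW.
have i0tilt j : p i0 (v + q l *: w) <= p j (v + q l *: w).
  rewrite !valE -subr_ge0 opprD addrACA -mulrBr.
  have [jw | jw] := ltP (p j w) (p i0 w); last first.
    by apply: addr_ge0; [rewrite subr_ge0|apply: mulr_ge0; rewrite ?subr_ge0].
  rewrite -[p j w - _]opprB mulrN subr_ge0 -ler_pdivlMr ?subr_gt0 //.
  exact: lmin.
have value i : p i (v + q l *: w) = p i0 (v + q l *: w) ->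
    i \in minimizers (v + q l *: w).
  by move=> iE; apply/minimizersP => j; rewrite iE.
exists (q l); apply/properP; split.
  apply/fintype.subsetP => i iv; apply: value; rewrite !valE (cst_w i iv).
  congr (_ + _); apply: le_anti; rewrite i0min andbT.
  by move/minimizersP: iv; exact.
exists l; last by apply: contraTN lw => /cst_w ->; rewrite ltxx.
apply: value; rewrite !valE; apply/eqP; rewrite -subr_eq0 opprD addrACA -mulrBr.
rewrite -[p l w - _]opprB mulrN subr_eq0 divfK //.
by rewrite subr_eq0 gt_eqF.
Qed.

Lemma minimizers_nonempty v (i : I) : exists i0, i0 \in minimizers v.
Proof.
case: (@arg_minP _ R I i xpredT (fun j => p j v) isT).
by move=> l _ lmin; exists l; apply/minimizersP => j; exact: lmin.
Qed.

Lemma most_minimizers (u : V^*) : u != 0 ->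
  exists2 v, u v != 0 &
    forall v', u v' != 0 -> (#|minimizers v'| <= #|minimizers v|)%N.
Proof.
move=> u0; pose Q m := `[< exists2 v, u v != 0 & #|minimizers v| = m >].
have exQ : exists m, Q m.
  have [v uv] : exists v, u v != 0.
    apply: contrapT => /forallNP u_eq0; move/eqP: u0; apply; apply/lfunP => v.
    by rewrite zero_lfunE; apply/eqP/negPn/negP/u_eq0.
  by exists #|minimizers v|; apply/asboolP; exists v.
have Qle m : Q m -> (m <= #|I|)%N.
  by move=> /asboolP[v _ <-]; exact: max_card.
case: (ex_maxnP exQ Qle) => m /asboolP[v uv <-] mmax.
by exists v => // v' uv'; apply: mmax; apply/asboolP; exists v'.
Qed.

Definition directions (A : {set I}) (i0 : I) : {vspace V^*} :=
  <<[seq p i - p i0 | i <- enum A]>>%VS.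

Lemma directions_mem (A : {set I}) i0 (a : I -> R) :
    (forall i, a i != 0 -> i \in A) -> \sum_i a i = 1 ->
  \sum_i a i *: p i - p i0 \in directions A i0.
Proof.
move=> aA a1; rewrite -[X in _ - X]scale1r -a1 scaler_suml -sumrB.
apply: memv_suml => i _; rewrite -scalerBr.
have [-> | /aA iA] := eqVneq (a i) 0; first by rewrite scale0r mem0v.
by apply/memvZ/memv_span/mapP; exists i; rewrite ?mem_enum.
Qed.

End Minimizers.

(** The facet is the face of D on which v is minimal, for a v that has as many
minimizers as possible among the vectors with u v <> 0.  The span U of the
differences of the minimizers then has dimension \dim V - 1: it does not contain
u, and together with u it spans the dual, as otherwise v could be tilted.  A
normal of the facet kills U, so it is zero if u kills it too. *)
Lemma facet_transverse (D : set V^*) (u : V^*) :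
    is_polytope D -> has_dim D (\dim {:V}) -> u != 0 ->
  exists2 F, is_facet D F & forall w, is_normal F w -> u w != 0.
Proof.
case=> s ->{D}; set D := conv_hull s => Ddim u0.
pose p (i : 'I_(size s)) : V^* := s`_i.
have [[x0 Dx0] [E [_ Emin dimE]]] := Ddim.
have Dp i : D (p i).
  exists (fun j => (j == i)%:R); split=> [j||]; first exact: ler0n.
    rewrite (bigD1 i) //= eqxx big1 ?addr0 // => j /negbTE -> //.
  rewrite (bigD1 i) //= eqxx scale1r big1 ?addr0 // => j /negbTE ->.
  by rewrite scale0r.
have [i] : exists i : 'I_(size s), True.
  case: Dx0 => a [_ a1 _]; have [i _|empty] := pickP 'I_(size s).
    by exists i.
  by move: a1; rewrite big_pred0 // => /eqP; rewrite eq_sym oner_eq0.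
have [v uv vmax] := most_minimizers p u0.
have [i0 i0min] := minimizers_nonempty p v i.
move=> _; pose A := minimizers p v; pose U := directions p A i0.
have min_val k : k \in A -> p k v = p i0 v.
  move=> kA; apply: le_anti; move/minimizersP: kA => ->.
  by move/minimizersP: i0min => ->.
have Uv : {in U, forall f : V^*, f v = 0}.
  apply: span_annihilates => f /mapP[k]; rewrite mem_enum => kA ->.
  by rewrite lfunBE min_val // subrr.
have uU : u \notin U by apply: contra uv => /Uv ->.
have Uu : (U + <[u]>)%VS = fullv.
  apply: contrapT => /eqP Uu.
  (* Tilting along w keeps u v <> 0, as u w = 0. *)
  have [|w w0 Uuw] := @annihilated_vector _ _ (U + <[u]>)%VS.
    by rewrite -dim_dual ltnNge; apply: contra Uu => ?; rewrite eqEdim subvf.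
  have uw : u w = 0 by apply: Uuw; rewrite memvE addvSr.
  have Uw f : f \in U -> f w = 0.
    by move=> fU; apply: Uuw; exact: (subvP (addvSl _ _)).
  have Aw : {in A, forall k, p k w = p i0 w}.
    move=> k kA; apply/eqP; rewrite -subr_eq0 -lfunBE; apply/eqP/Uw.
    by apply/memv_span/mapP; exists k; rewrite ?mem_enum.
  (* A point below p i0 in the direction w or - w would allow a tilt. *)
  have not_below w' k : w' = w \/ w' = - w -> p i0 w' <= p k w'.
    move=> w'E; rewrite leNgt; apply/negP => kw'.
    have [|t tprop] := minimizers_tilt i0min _ kw'.
      by case: w'E => -> j jA; rewrite ?linearN /= Aw.
    have uw' : u w' = 0 by case: w'E => ->; rewrite ?linearN /= uw ?oppr0.
    have /vmax : u (v + t *: w') != 0.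
      by rewrite linearD linearZ /= uw' scaler0 addr0.
    by rewrite leqNgt proper_card.
  (* So w is constant on all the points p k, whose differences span the dual
     as D is full-dimensional; hence every functional kills w. *)
  have [f /negP[]] := separating_functional w0; apply/eqP.
  have : f \in directions p [set: 'I_(size s)] i0.
    apply: (subvP (Emin _ _)); last first.
      suff -> : E = fullv by exact: memvf.
      by apply/eqP; rewrite eqEdim subvf dim_dual dimE /=.
    apply: (@contains_differences_pivot (p i0)) => _ [a [_ a1 ->]].
    by apply: directions_mem => // k _; rewrite inE.
  move: f; apply: span_annihilates => _ /mapP[k _ ->].
  rewrite lfunBE; apply/eqP; rewrite subr_eq0 eq_le.
  rewrite -[X in X && _]lerN2 -!linearN.
  by rewrite !not_below //; [left|right].
have value (a : 'I_(size s) -> R) : \sum_k a k = 1 ->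
    (\sum_k a k *: p k) v - p i0 v = \sum_k a k * (p k v - p i0 v).
  move=> a1; rewrite sum_lfunE -[X in _ - X]mul1r -a1 mulr_suml -sumrB.
  by apply: eq_bigr => k _; rewrite scale_lfunE mulrBr.
have term_ge0 (a : 'I_(size s) -> R) k :
    0 <= a k -> 0 <= a k * (p k v - p i0 v).
  move=> ak; rewrite mulr_ge0 // subr_ge0.
  by move/minimizersP: i0min; exact.
pose F := D `&` [set eta : V^* | eta v = p i0 v].
have Fp k : k \in A -> F (p k) by move=> kA; split=> //; exact: min_val.
exists F.
  split.
    split; first by exists (p i0); exact: Fp.
    exists v, (p i0 v); split=> // _ [a [a0 a1 ->]].
    rewrite -subr_ge0 value // sumr_ge0 // => k _.
    exact: term_ge0.
  exists (\dim U); last first.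
    split; first by exists (p i0); exact: Fp.
    exists U; split=> //; last first.
      move=> U' U'F; apply/span_subvP => f /mapP[k].
      by rewrite mem_enum => kA ->; apply: U'F; exact: Fp.
    apply: (@contains_differences_pivot (p i0)) => _ [[a [a0 a1 ->]] /= /eqP].
    (* A convex combination is on the face only if its support is. *)
    rewrite -subr_eq0 value // => /eqP sum0.
    apply: directions_mem => // k ak; apply/minimizersP => j.
    have /(_ k isT)/eqP := psumr_eq0P (fun l _ => term_ge0 a l (a0 l)) sum0.
    rewrite mulf_eq0 (negPf ak) subr_eq0 => /eqP ->.
    by move/minimizersP: i0min; exact.
  have -> // : (\dim U).+1 = \dim {:V}.
  rewrite -dim_dual -Uu dimv_disjoint_sum ?dim_vline ?u0 ?addn1 //.
  apply/eqP; rewrite -subv0; apply/subvP => f; rewrite memv_cap memv0.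
  move=> /andP[fU /vlineP[c fE]]; move: fU; rewrite fE.
  have [-> | c0] := eqVneq c 0; first by rewrite scale0r eqxx.
  by move=> /(memvZ c^-1); rewrite scalerK // (negPf uU).
move=> w [w0 Fw]; apply: contraNneq w0 => uw; apply/negPn/negP => w0.
have Uw : {in U, forall f : V^*, f w = 0}.
  apply: span_annihilates => f /mapP[k]; rewrite mem_enum => kA ->.
  by rewrite lfunBE (Fw _ (p i0)) ?subrr //; exact: Fp.
have [f /negP[]] := separating_functional w0; apply/eqP.
have := memvf f; rewrite -Uu => /memv_addP[g gU [_ /vlineP[c ->] ->]].
by rewrite add_lfunE scale_lfunE uw scaler0 addr0 Uw.
Qed.

Lemma facet_normals_span (D : set V^*) (S : {vspace V}) :
    is_polytope D -> has_dim D (\dim {:V}) ->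
    (forall F, is_facet D F -> exists2 w, w \in S & is_normal F w) ->
  S = fullv.
Proof.
move=> Dpoly Ddim normS; apply: contrapT => /eqP.
move=> /annihilating_functional[u u0 uS].
have [F /normS[w wS Fw] /(_ w Fw)] := facet_transverse Dpoly Ddim u0.
by rewrite uS // eqxx.
Qed.

End FacetNormals.

(** * The components of the kernel of the torus homomorphism *)

Lemma sum_continuous (K : numFieldType) (T : topologicalType)
    (W : normedModType K) (I : Type) (r : seq I) (f : I -> T -> W) :
  (forall i, continuous (f i)) -> continuous (fun x => \sum_(i <- r) f i x).
Proof.
move=> cf; elim: r => [|i r IH] x.
  under eq_fun do rewrite big_nil.
  exact: cst_continuous.
under eq_fun do rewrite big_cons.
by apply: continuousD; [exact: cf|exact: IH].
Qed.

Section Components.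
Variables (R : realType) (d n : nat) (N : zmodType).
Variables (c : {additive N -> 'rV[int]_d}) (beta : {additive 'rV[int]_n -> N}).
Hypothesis c_bij : bijective c.

Local Notation betaR := (@betaR R d n N c beta).
Local Notation tens1 := (@tens1 R d N c).
Local Notation coker := (coker beta).
Local Notation exp := (@exp R n).
Local Notation K := [set` @KD_pred R d n N c beta].
Local Notation phi := (phi R c beta).

Lemma betaRZ a y : betaR (a *: y) = a *: betaR y.
Proof.
by rewrite /Defs.betaR scaler_sumr; apply: eq_bigr => i _; rewrite mxE scalerA.
Qed.

Lemma betaR_linear : linear betaR.
Proof. by move=> a x y; rewrite raddfD /= betaRZ. Qed.

Lemma betaR_continuous : continuous betaR.
Proof.
apply: sum_continuous => i y.
apply: (@continuous_comp _ _ _ (fun y : 'rV[R]_n => y 0 i) (fun a => a *: _)).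
  exact: coord_continuous.
exact: scalel_continuous.
Qed.

Lemma tens1_inj : injective tens1.
Proof.
move=> x x' /matrixP xx'; apply: (bij_inj c_bij); apply/matrixP => i j.
by have /eqP := xx' i j; rewrite !mxE eqr_int => /eqP.
Qed.

Lemma tens1_surj v : v \in @int_rV R d -> exists x, v = tens1 x.
Proof.
move=> /mxOverP vint; have [c' _ c'K] := c_bij.
exists (c' (map_mx Num.floor v)); apply/matrixP => i j.
by rewrite /Defs.tens1 c'K !mxE; have /floorK := vint i j.
Qed.

(** Balls are for the sup norm, and a nonzero integer has absolute value at
least 1. *)
Lemma tens1_discrete x x' : ball (tens1 x) 1 (tens1 x') -> x = x'.
Proof.
move=> [_ xx']; apply: tens1_inj; apply/eqP; rewrite -subr_eq0; apply/eqP.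
apply/matrixP => i j; rewrite [RHS]mxE; apply/eqP; apply: contraTT (xx' i j).
move=> /norm_intr_ge1; rewrite -leNgt !mxE; apply.
by rewrite rpredB ?intr_int.
Qed.

Lemma pi_coker_eq0 x : (\pi_coker x == 0) = (x \in im_beta beta).
Proof. by rewrite -(raddf0 (\pi_coker)) -Quotient.idealrBE subr0. Qed.

Lemma pi_coker_beta x z : \pi_coker (x + beta z) = \pi_coker x.
Proof.
apply/eqP; rewrite -Quotient.idealrBE addrC addKr; apply/asboolP.
by exists z.
Qed.

Lemma exp_eq y y' : exp y = exp y' -> exists z, y' = y + map_mx intr z.
Proof.
move=> /eqP; rewrite eq_sym -subr_eq0 -raddfB exp_eq0 => /mxOverP yint.
exists (map_mx Num.floor (y' - y)); rewrite addrC; apply/eqP.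
rewrite -subr_eq; apply/eqP/matrixP => i j.
by have /floorK := yint i j; rewrite !mxE => ->.
Qed.

(** An open set of the torus meeting K in the points whose class in coker beta
satisfies Q. *)
Definition tube (Q : set coker) : set (torus R n) :=
  exp @` (betaR @^-1`
    \bigcup_(x in [set x | Q (\pi_coker x)]) ball (tens1 x) 1).

(** An integer translation of y moves x within its class modulo the image of
beta, so the preimage of the tube under exp is no larger than the open set that
defines it. *)
Lemma tube_open Q : open (tube Q).
Proof.
change (open (exp @^-1` tube Q)); suff -> : exp @^-1` tube Q =
  betaR @^-1` \bigcup_(x in [set x | Q (\pi_coker x)]) ball (tens1 x) 1.
  move/continuousP: betaR_continuous; apply; apply: bigcup_open => x _.
  exact: ball_open.
apply/seteqP; split=> [y [y' [x Qx yx] /exp_eq[z ->]]|y yQ]; last by exists y.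
exists (x + beta z); first by rewrite /= pi_coker_beta.
move: yx; rewrite -!ball_normE /ball_ /= !raddfD /= betaR_tens1.
by rewrite addrACA subrr addr0.
Qed.

Lemma tubeE Q x y : betaR y = tens1 x -> tube Q (exp y) <-> Q (\pi_coker x).
Proof.
move=> yx; split=> [[y' [x' Qx' yx'] /esym/exp_eq[z zE]]|Qx].
  move: yx'; rewrite zE /= raddfD /= betaR_tens1 yx -raddfD => /tens1_discrete.
  by move=> x'E; move: Qx'; rewrite /= x'E pi_coker_beta.
by exists y => //; exists x => //=; rewrite yx; exact: ballxx.
Qed.

Lemma K_lift t : t \in K -> exists y x, exp y = t /\ betaR y = tens1 x.
Proof.
rewrite inE /= inE => /eqP; rewrite -[t]reprK -[\pi_(_) _]/(exp _) betabar_exp.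
move=> /eqP; rewrite exp_eq0 => /tens1_surj[x xE].
by exists (repr t), x.
Qed.

(** The tubes of the class 0 and of the other classes split K into two
relatively open parts, so a connected subset of K containing 0 is inside the
first. *)
Lemma component_coker0 x y : betaR y = tens1 x ->
  connected_component K 0 (exp y) -> \pi_coker x = 0.
Proof.
move=> yx [C [C0 CK Cconn] Cy].
suff : tube [set 0] (exp y) by move/(tubeE _ yx).
suff /seteqP[_ /(_ _ Cy)[]] : C `&` tube [set 0] = C by [].
apply: Cconn.
- exists 0; split=> //; rewrite -(raddf0 exp).
  by apply/(@tubeE _ 0); rewrite ?raddf0.
- by exists (tube [set 0]) => //; exact: tube_open.
exists (~` tube (~` [set 0])); first exact/open_closedC/tube_open.
apply/seteqP; split=> t [Ct tQ]; split=> //; move: tQ;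
  have /mem_set/K_lift[y' [x' [<- y'x']]] := CK _ Ct => /=.
  by move=> /(tubeE _ y'x') x'0 /(tubeE _ y'x'); apply.
move=> ntQ; apply/(tubeE _ y'x'); apply: contrapT => x'0; apply: ntQ.
exact/(tubeE _ y'x').
Qed.

Lemma ker_component y : betaR y = 0 -> connected_component K 0 (exp y).
Proof.
move=> y0; pose f (a : R) := exp (a *: y).
apply: (@connected_component_max _ _ (f @` `[0, 1]%classic)).
- by exists 0; rewrite /f ?scale0r ?raddf0 //= in_itv /= lexx ler01.
- move=> _ [a _ <-] /=; rewrite inE /f betabar_exp betaRZ y0 scaler0.
  by rewrite raddf0.
- apply: connected_continuous_connected; first exact: segment_connected.
  apply: continuous_subspaceT => a; apply: continuous_comp.
    exact: scalel_continuous.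
  exact: exp_continuous.
by exists 1; rewrite /f ?scale1r //= in_itv /= lexx ler01.
Qed.

(** Two choices of y differ by an element of the kernel of betaR, which exp
sends to the identity component. *)
Lemma phi_exp x y (yx : betaR y = tens1 x) :
  phi x = \pi_(pi0_KD R c beta) (exp_KD yx).
Proof.
rewrite /Defs.phi; case: pselect => [ex|]; last by case; exists y.
apply/eqP; rewrite -Quotient.idealrBE; apply/asboolP; rewrite /= -raddfB.
by apply: ker_component; rewrite raddfB /= (projT2 (cid ex)) yx subrr.
Qed.

Hypothesis betaR_surj : forall v, exists y, betaR y = v.

Lemma phiB : zmod_morphism phi.
Proof.
move=> x x'; have [y yx] := betaR_surj (tens1 x).
have [y' yx'] := betaR_surj (tens1 x').
have yyxx : betaR (y - y') = tens1 (x - x') by rewrite !raddfB /= yx yx'.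
rewrite (phi_exp yx) (phi_exp yx') (phi_exp yyxx) -raddfB; congr (\pi_(_) _).
by apply: val_inj; rewrite /= raddfB.
Qed.

Lemma phi_eq0 x : (phi x == 0) = (\pi_coker x == 0).
Proof.
have [y yx] := betaR_surj (tens1 x).
rewrite (phi_exp yx) -(raddf0 (\pi_(pi0_KD R c beta))) -Quotient.idealrBE subr0.
apply/asboolP/idP => [/(component_coker0 yx) ->|]; first by rewrite eqxx.
rewrite pi_coker_eq0 => /asboolP[z xz] /=.
have -> : exp y = exp (y - map_mx intr z).
  apply/eqP; rewrite -subr_eq0 -raddfB exp_eq0 subKr; apply/mxOverP => i j.
  by rewrite mxE intr_int.
by apply: ker_component; rewrite raddfB /= betaR_tens1 yx xz subrr.
Qed.

Lemma phi_surj k : exists x, phi x = k.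
Proof.
rewrite -[k]reprK; case: (repr k) => t tK.
have [y [x [tE yx]]] := K_lift (mem_set tK).
by exists x; rewrite (phi_exp yx); congr (\pi_(_) _); exact: val_inj.
Qed.

Definition phibar (q : coker) : pi0_KD R c beta := phi (repr q).

Lemma phibar_pi x : phibar (\pi_coker x) = phi x.
Proof.
apply/eqP; rewrite -subr_eq0 -phiB phi_eq0 raddfB /= subr_eq0.
by rewrite [X in X == _]reprK.
Qed.

Lemma phibarB : zmod_morphism phibar.
Proof.
move=> p q; rewrite -[p]reprK -[q]reprK -raddfB !phibar_pi; exact: phiB.
Qed.

Lemma phibar_bij : bijective phibar.
Proof.
rewrite -setTT_bijective; split=> // [p q _ _|k _].
  rewrite -[p]reprK -[q]reprK !phibar_pi => /eqP.
  by rewrite -subr_eq0 -phiB phi_eq0 raddfB subr_eq0 => /eqP.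
by have [x <-] := phi_surj k; exists (\pi_coker x) => //; exact: phibar_pi.
Qed.

End Components.

(** * The isomorphism *)

(** Up to the factor [label P i], the facet normal [tens1 R c (nu i)] is the
image of a basis vector. *)
Lemma betaR_surj (R : realType) (d n : nat) (N : zmodType)
    (c : {additive N -> 'rV[int]_d}) (P : labelled_polytope R n c)
    (nu : 'I_n -> N) (nuP : forall i, primitive_inward_normal P i (nu i))
    (beta : {additive 'rV[int]_n -> N})
    (betaE : forall i, beta (delta_mx 0 i) = nu i *+ label P i)
    (v : 'rV[R]_d) :
  exists y, betaR c beta y = v.
Proof.
pose betaL : {linear 'rV[R]_n -> 'rV[R]_d} :=
  HB.pack (betaR c beta)
    (GRing.isLinear.Build R _ _ _ _ (@betaR_linear R d n N c beta)).
have img_full : limg (linfun betaL) = fullv.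
  apply: (facet_normals_span (carrier_polytope P)).
    by rewrite dimvf /dim /= mul1n; exact: carrier_full_dim.
  move=> F /facetP[i ->].
  exists (tens1 R c (nu i)); last by case: (nuP i) => _ [].
  have -> : tens1 R c (nu i) =
      linfun betaL ((label P i)%:R^-1 *: map_mx intr (delta_mx 0 i)).
    rewrite lfunE /= betaRZ betaR_tens1 betaE raddfMn /=.
    rewrite -[X in _ *: X]scaler_nat scalerA mulVf ?scale1r // pnatr_eq0 -lt0n.
    exact: label_gt0.
  by apply: memv_img; exact: memvf.
have := memvf v; rewrite -img_full => /memv_imgP[y _ ->].
by exists y; rewrite lfunE.
Qed.

Theorem proposition2p17 (R : realType) (d n : nat) (N : zmodType)
    (c : {additive N -> 'rV[int]_d}) (c_bij : bijective c)
    (P : labelled_polytope R n c) (nu : 'I_n -> N)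
    (nuP : forall i, primitive_inward_normal P i (nu i))
    (beta : {additive 'rV[int]_n -> N})
    (betaE : forall i, beta (delta_mx 0 i) = nu i *+ label P i) :
  [/\ forall x : N, exists y : 'rV[R]_n, betaR c beta y = tens1 R c x,
      forall (x : N) (y : 'rV[R]_n) (yx : betaR c beta y = tens1 R c x),
        phi R c beta x = \pi_(pi0_KD R c beta) (exp_KD yx)
    & exists phibar : {additive coker beta -> pi0_KD R c beta},
        bijective phibar /\
        forall x : N, phibar (\pi_(coker beta) x) = phi R c beta x].
Proof.
have surj := betaR_surj nuP betaE.
split=> [x|x y yx|]; [exact: surj|exact: phi_exp|].
pose phibarA : {additive coker beta -> pi0_KD R c beta} :=
  HB.pack (@phibar R d n N c beta)
    (GRing.isZmodMorphism.Build _ _ _ (phibarB c_bij surj)).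
exists phibarA; split; first exact: phibar_bij c_bij surj.
by move=> x; exact: (phibar_pi c_bij surj).
Qed.
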